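(* Let $n\ge1$ be an integer that is not a multiple of $4$, and let $a_x$ ($x\in(\mathbb{Z}_2)^n$) and $b_y$ ($y\in H_n$) be commuting variables. Then the bilinear forms $$c_x=\sum_{y\in H_n}(-1)^{f_{\mathbb{O}}(x+y,\,y)}\,a_{x+y}\,b_y,\qquad x\in(\mathbb{Z}_2)^n,$$ are a solution to the Hurwitz–Radon identity for $N=2^n$, i.e. $$\Big(\sum_{x\in(\mathbb{Z}_2)^n}a_x^2\Big)\Big(\sum_{y\in H_n}b_y^2\Big)=\sum_{x\in(\mathbb{Z}_2)^n}c_x^2 .$$
   Context: The function $f_{\mathbb{O}}:(\mathbb{Z}_2)^n\times(\mathbb{Z}_2)^n\to\mathbb{Z}_2$ is $$f_{\mathbb{O}}(x,y)=\sum_{1\le i<j<k\le n}(x_ix_jy_k+x_iy_jx_k+y_ix_jx_k)+\sum_{1\le i\le j\le n}x_iy_j .$$ Elements of $(\mathbb{Z}_2)^n$: $e_0=(0,\ldots,0)$, $\overline{e_0}=(1,\ldots,1)$; for $1\le i\le n$, $e_i$ has a $1$ at position $i$ and $0$ elsewhere, and $\overline{e_i}$ has a $0$ at position $i$ and $1$ elsewhere. The subset $H_n\subset(\mathbb{Z}_2)^n$ is $H_n=\{e_i,\overline{e_i}: 1\le i\le n\}$ if $n\equiv1\pmod 4$; $H_n=\{e_i: 0\le i\le n\}\cup\{e_1+e_j: 1<j\le n\}$ if $n\equiv2\pmod 4$; $H_n=\{e_i,\overline{e_i}: 0\le i\le n\}$ if $n\equiv3\pmod 4$. In each case $H_n$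 has exactly $\rho(2^n)$ elements, where $\rho$ is the Hurwitz–Radon function: $\rho(N)=8m+2^\ell$ for $N=2^{4m+\ell}N'$ with $N'$ odd and $\ell\in\{0,1,2,3\}$. *)

(* Defs.v *)
From HB Require Import structures.
From mathcomp Require Import all_boot all_order all_algebra.

Set Implicit Arguments.
Unset Strict Implicit.
Unset Printing Implicit Defensive.

Import GRing.Theory.
Local Open Scope ring_scope.

(* The positions 1, ..., n of (Z_2)^n are numbered 0, ..., n-1 by 'I_n. *)
Definition f_oct (n : nat) (x y : 'rV['Z_2]_n) : 'Z_2 :=
  \sum_(i < n) \sum_(j < n | (i < j)%N) \sum_(k < n | (j < k)%N)
     (x 0 i * x 0 j * y 0 k + x 0 i * y 0 j * x 0 k + y 0 i * x 0 j * x 0 k)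
  + \sum_(i < n) \sum_(j < n | (i <= j)%N) x 0 i * y 0 j.

Definition e0 (n : nat) : 'rV['Z_2]_n := 0.
Definition e0bar (n : nat) : 'rV['Z_2]_n := const_mx 1.
Definition e (n : nat) (i : 'I_n) : 'rV['Z_2]_n := \row_j (j == i)%:R.
Definition ebar (n : nat) (i : 'I_n) : 'rV['Z_2]_n := \row_j (j != i)%:R.

(* The sums e_1 + e_j, 1 < j <= n, are written without assuming that 'I_n is
   inhabited: i is constrained to be the first position. The value on
   multiples of 4, where H_n is not defined, is a placeholder. *)
Definition Hset (n : nat) : {set 'rV['Z_2]_n} :=
  match (n %% 4)%N with
  | 1 => [set e i | i : 'I_n] :|: [set ebar i | i : 'I_n]
  | 2 => e0 n |: [set e i | i : 'I_n]
         :|: [set e i + e j | i in 'I_n, j in 'I_n & (val i == 0%N) && (val i < val j)%N]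
  | 3 => e0 n |: [set e i | i : 'I_n] :|: (e0bar n |: [set ebar i | i : 'I_n])
  | _ => set0
  end.

(* N = 2 ^ (4 m + l) * N' with N' odd means 4 m + l = logn 2 N. *)
Definition hurwitz_radon (N : nat) : nat :=
  (8 * (logn 2 N %/ 4) + 2 ^ (logn 2 N %% 4))%N.

(* b is only evaluated on Hset n. The exponent is read through the coercion of
   'Z_2 to its representatives 0 and 1 in nat. *)
Definition cform (R : comNzRingType) (n : nat)
    (a b : 'rV['Z_2]_n -> R) (x : 'rV['Z_2]_n) : R :=
  \sum_(y in Hset n) (-1) ^+ f_oct (x + y) y * a (x + y) * b y.

(* Main.v *)
Require Import Defs.
From mathcomp Require Import all_boot all_order all_algebra.
From mathcomp Require Import ring zify.

Set Implicit Arguments.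
Unset Strict Implicit.
Unset Printing Implicit Defensive.

(** The cubic part of [f_oct] is linear in [y], and its polarisation in [x]
    vanishes modulo 2 when one argument is [y]. Hence the sign condition making
    the cross terms of [b y * b z] cancel reduces to [f_oct w w = 1] for
    [w = y + z]. Since [f_oct w w] is 3 C(m, 3) + C(m, 2) + m mod 2 with [m] the
    Hamming weight of [w], this says that [m] is not a multiple of 4, which holds
    for any two distinct elements of [Hset n]. *)

Import GRing.Theory.
Local Open Scope ring_scope.

(** * Additivity and diagonal values of [f_oct] *)

Lemma addZ2_self (x : 'Z_2) : x + x = 0.
Proof. by apply/val_inj; case: x => [[|[|]]]. Qed.

Lemma addrowZ2_self n (x : 'rV['Z_2]_n) : x + x = 0.
Proof. by apply/rowP => i; rewrite !mxE addZ2_self. Qed.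

Lemma addrowZ2K n (x : 'rV['Z_2]_n) : involutive (+%R^~ x).
Proof. by move=> u; rewrite -addrA addrowZ2_self addr0. Qed.

(** Exponents are natural representatives and [x + y] is reduced modulo 2, but a power of -1 only
    sees parity. *)
Lemma signrZ2D (R : comNzRingType) (x y : 'Z_2) :
  (-1) ^+ (x + y)%R = (-1) ^+ x * (-1) ^+ y :> R.
Proof. by rewrite -exprD -[RHS]signr_odd -[LHS]signr_odd /= -!modn2 modn_mod. Qed.

Lemma f_octDr n (x y z : 'rV['Z_2]_n) :
  f_oct x (y + z) = f_oct x y + f_oct x z.
Proof.
rewrite /f_oct [RHS]addrACA; congr (_ + _); rewrite -big_split /=.
  apply: eq_bigr => i _; rewrite -big_split /=; apply: eq_bigr => j _.
  by rewrite -big_split /=; apply: eq_bigr => k _; rewrite !mxE; ring.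
apply: eq_bigr => i _; rewrite -big_split /=; apply: eq_bigr => j _.
by rewrite !mxE; ring.
Qed.

Lemma f_octDl_diag n (x w : 'rV['Z_2]_n) :
  f_oct (x + w) w = f_oct x w + f_oct w w.
Proof.
rewrite /f_oct [RHS]addrACA; congr (_ + _); rewrite -big_split /=.
  apply: eq_bigr => i _; rewrite -big_split /=; apply: eq_bigr => j _.
  rewrite -big_split /=; apply: eq_bigr => k _; rewrite !mxE.
  (* Each monomial mixing one [x] with two [w] occurs twice in the expansion, so the excess is
     [s + s]. *)
  set s := x 0 i * w 0 j * w 0 k + w 0 i * x 0 j * w 0 k
           + w 0 i * w 0 j * x 0 k.
  by rewrite -[RHS]addr0 -(addZ2_self s) /s; ring.
apply: eq_bigr => i _; rewrite -big_split /=; apply: eq_bigr => j _.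
by rewrite !mxE; ring.
Qed.

(** Sort the [r.+1]-subsets of the support of [v] from [p] on by their least element [j]: the other
    [r] elements lie after [j]. This collapses nested sums over i < j < k one index at a time. *)
Lemma sum_bin_tail n (v : 'I_n -> bool) r p :
  (\sum_(j < n | p <= j) v j * 'C(\sum_(k < n | j < k) v k, r)
   = 'C(\sum_(k < n | p <= k) v k, r.+1))%N.
Proof.
have [d] := ubnP (n - p)%N; elim: d => // d IHd in p *; rewrite ltnS => le_d.
have [le_np|lt_pn] := leqP n p.
  by rewrite !big_pred0 // => i; have := ltn_ord i; lia.
have pE (i : 'I_n) : (p <= i)%N && (i != Ordinal lt_pn) = (p < i)%N.
  by rewrite -val_eqE /=; lia.
rewrite [LHS](bigD1 (Ordinal lt_pn)) //= [in RHS](bigD1 (Ordinal lt_pn)) //=.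
rewrite !(eq_bigl _ _ pE) IHd; last by lia.
by case: (v _); rewrite ?mul1n ?mul0n ?add0n // add1n binS addnC.
Qed.

(** The Hamming weight: entries are summed as natural numbers, without reduction modulo 2. *)
Definition wt n (w : 'rV['Z_2]_n) : nat := (\sum_(k < n) w 0%R k)%N.

Lemma f_oct_diag n (w : 'rV['Z_2]_n) :
  f_oct w w = (3 * 'C(wt w, 3) + ('C(wt w, 2) + wt w))%:R.
Proof.
pose v k := w 0 k == 1; pose m p := (\sum_(k < n | (p <= k)%N) v k)%N.
have vN k : w 0 k = v k :> nat by rewrite /v; case: (w 0 k) => [[|[|]]].
have vR k : w 0 k = (v k)%:R.
  by apply/val_inj; rewrite /= vN; case: (v k).
have m0 : wt w = m 0%N by rewrite /wt /m; apply: eq_bigr.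
have E1 p : \sum_(k < n | (p <= k)%N) w 0 k = ('C(m p, 1))%:R.
  by rewrite bin1 natr_sum; apply: eq_bigr => k _; rewrite vR.
have E r p : \sum_(k < n | (p <= k)%N) w 0 k * ('C(m k.+1, r))%:R
    = ('C(m p, r.+1))%:R.
  by rewrite -sum_bin_tail natr_sum; apply: eq_bigr => k _; rewrite vR -natrM.
rewrite /f_oct m0 natrD natrM natrD; congr (_ + _).
  rewrite -(E 2 0%N) mulr_sumr; apply: eq_bigr => i _.
  rewrite -(E 1%N) mulrA mulr_sumr; apply: eq_bigr => j _.
  rewrite -E1 !mulr_sumr; apply: eq_bigr => k _; ring.
(* In the quadratic part the terms j = i are squares, equal to [w 0 i], and sum to the weight; the
   pairs i < j give the binomial. *)
have := E1 0%N; rewrite bin1 => <-; rewrite -(E 1%N 0%N) -big_split /=.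
apply: eq_bigr => i _; rewrite (bigD1 i) //= addrC; congr (_ + _).
  rewrite -E1 mulr_sumr; apply: eq_bigl => j; rewrite -val_eqE /=; lia.
by rewrite vR; case: (v i); rewrite ?mulr1 ?mulr0.
Qed.

(** By Pascal's rule the parity of ['C(m.+1, 3)] involves that of ['C(m, 2)], so both go through one
    induction. *)
Lemma odd_bin2_bin3 m :
  (odd 'C(m, 2) = (1 < m %% 4)%N) * (odd 'C(m, 3) = (m %% 4 == 3)%N).
Proof.
elim: m => [|m [IH2 IH3]] //.
by rewrite !binS bin1 !oddD IH2 IH3 ?bin0; split; lia.
Qed.

Lemma f_oct_diag_eq1 n (w : 'rV['Z_2]_n) : ~~ (4 %| wt w)%N -> f_oct w w = 1.
Proof.
move=> w4; rewrite f_oct_diag; apply: val_inj.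
rewrite [LHS]val_Zp_nat // modn2 oddD oddM oddD !odd_bin2_bin3 /=.
by move: (wt w) w4 => m; rewrite [RHS]/(true : nat); lia.
Qed.

(** * Hamming weights of sums and complements *)

Lemma wt_eq0 n (w : 'rV['Z_2]_n) : (wt w == 0%N) = (w == 0).
Proof.
rewrite /wt sum_nat_eq0; apply/forallP/eqP => [w0|-> k]; last by rewrite mxE.
by apply/rowP => k; apply/val_inj; rewrite mxE; apply/eqP/(w0 k).
Qed.

Lemma wtD n (y z : 'rV['Z_2]_n) : (wt (y + z) <= wt y + wt z)%N.
Proof.
rewrite /wt -big_split /=; apply: leq_sum => k _.
by rewrite mxE /= leq_mod.
Qed.

Lemma odd_wtD n (y z : 'rV['Z_2]_n) : odd (wt (y + z)) = odd (wt y) (+) odd (wt z).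
Proof.
rewrite -oddD /wt -big_split /= !(big_morph odd oddD (erefl _)).
apply: eq_bigr => k _; rewrite mxE; move: (y 0 k) (z 0 k).
by do 2![case=> [[|[|]] ?] //].
Qed.

Lemma wt_compl n (w : 'rV['Z_2]_n) : (wt (e0bar n + w) + wt w)%N = n.
Proof.
rewrite /wt -big_split /= -[RHS]card_ord -sum1_card; apply: eq_bigr => k _.
by rewrite !mxE /=; case: (w 0 k) => [[|[|]]].
Qed.

Lemma subn_wt n (w : 'rV['Z_2]_n) : (n - wt w = wt (e0bar n + w))%N.
Proof. by rewrite -[X in (X - _)%N](wt_compl w) addnK. Qed.

Lemma wt_e n (i : 'I_n) : wt (e i) = 1%N.
Proof.
rewrite /wt (bigD1 i) //= big1 ?mxE ?eqxx // => k /negPf ki.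
by rewrite mxE ki.
Qed.

Lemma wt_e0 n : wt (e0 n) = 0%N.
Proof. by apply/eqP; rewrite wt_eq0. Qed.

Lemma ebarE n (i : 'I_n) : ebar i = e0bar n + e i.
Proof.
by apply/rowP => k; rewrite !mxE; case: eqP => _; apply/val_inj.
Qed.

Lemma e_inj n : injective (@e n).
Proof.
move=> i j /rowP/(_ i); rewrite !mxE eqxx.
by case: eqP.
Qed.

Lemma wt_pos n (y z : 'rV['Z_2]_n) : y != z -> (0 < wt (y + z))%N.
Proof.
move=> yz; rewrite lt0n wt_eq0; apply: contraNneq yz => yz0.
by rewrite -(addrowZ2K z y) yz0 add0r.
Qed.

Lemma wtD_small n (y z : 'rV['Z_2]_n) :
  (wt y + wt z < 4)%N -> y != z -> ~~ (4 %| wt (y + z))%N.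
Proof.
by move=> yz4 yz; rewrite gtnNdvd ?wt_pos // (leq_ltn_trans (wtD y z)).
Qed.

Lemma addrowZ2_cancel n (c y z : 'rV['Z_2]_n) : (c + y) + (c + z) = y + z.
Proof. by rewrite addrACA addrowZ2_self add0r. Qed.

(** For odd [n], [Hset n] is such a union. An element plus a complement has weight [n - wt (y + z)],
    where [y = z] may occur; between two complements [e0bar n] cancels. *)
Lemma wt_double n (A : {set 'rV['Z_2]_n}) :
  {in A &, forall y z, ~~ (4 %| n - wt (y + z))%N} ->
  {in A &, forall y z, y != z -> ~~ (4 %| wt (y + z))%N} ->
  {in A :|: [set e0bar n + y | y in A] &,
    forall y z, y != z -> ~~ (4 %| wt (y + z))%N}.
Proof.
move=> hc hA y z; rewrite !inE.
have hcD u w : u \in A -> w \in A -> ~~ (4 %| wt (e0bar n + u + w))%N.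
  by move=> uA wA; rewrite -addrA -subn_wt hc.
move=> /orP[yA|/imsetP[u uA ->]] /orP[zA|/imsetP[w wA ->]] yz.
- exact: hA.
- by rewrite addrC hcD.
- by rewrite hcD.
- by rewrite addrowZ2_cancel hA //; apply: contraNneq yz => ->.
Qed.

Lemma card_double n (A : {set 'rV['Z_2]_n}) :
  {in A &, forall y z, ~~ (4 %| n - wt (y + z))%N} ->
  #|A :|: [set e0bar n + y | y in A]| = (2 * #|A|)%N.
Proof.
move=> hc; rewrite cardsU disjoint_setI0 ?cards0 ?subn0.
  by rewrite card_imset ?mul2n ?addnn //; apply: addrI.
rewrite -setI_eq0; apply/eqP/setP => y; rewrite !inE.
(* A common element [y], the complement of some [u] in [A], would give [n - wt (u + y) = 0], a
   multiple of 4. *)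
apply/negP => /andP[yA /imsetP[u uA yE]]; have := hc u y uA yA.
by rewrite subn_wt addrA -yE addrowZ2_self [wt _]wt_e0.
Qed.

Lemma wt_e0_e n (y : 'rV['Z_2]_n) :
  y \in e0 n |: [set e i | i : 'I_n] -> (wt y <= 1)%N.
Proof. by rewrite !inE => /orP[/eqP->|/imsetP[i _ ->]]; rewrite ?wt_e0 ?wt_e. Qed.

Lemma card_e n : #|[set e i | i : 'I_n]| = n.
Proof. by rewrite card_imset ?card_ord //; apply: e_inj. Qed.

Lemma card_e0_e n : #|e0 n |: [set e i | i : 'I_n]| = n.+1.
Proof.
rewrite cardsU1 card_e; case: imsetP => // -[i _ /(congr1 (@wt n))].
by rewrite wt_e0 wt_e.
Qed.

(** * The sets [Hset n] according to [n] modulo 4 *)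

Lemma Hset1 n : (n %% 4 = 1)%N ->
  Hset n = [set e i | i : 'I_n] :|:
           [set e0bar n + y | y in [set e i | i : 'I_n]].
Proof.
move=> n1; rewrite /Hset n1 -imset_comp; congr (_ :|: _).
by apply: eq_imset => i; rewrite /= ebarE.
Qed.

Lemma Hset3 n : (n %% 4 = 3)%N ->
  Hset n = (e0 n |: [set e i | i : 'I_n]) :|:
           [set e0bar n + y | y in e0 n |: [set e i | i : 'I_n]].
Proof.
move=> n3; rewrite /Hset n3 imsetU1 [e0bar n + e0 n]addr0 -imset_comp.
by congr (_ :|: (_ |: _)); apply: eq_imset => i; rewrite /= ebarE.
Qed.

Lemma Hset2 n (i0 : 'I_n) : (n %% 4 = 2)%N -> val i0 = 0%N ->
  Hset n = e0 n |: [set e i | i : 'I_n] :|: [set e i0 + e j | j in [set~ i0]].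
Proof.
move=> n2 i00; rewrite /Hset n2; congr (_ :|: _); apply/setP => y.
apply/imset2P/imsetP => [[i j _ + ->]|[j + ->]].
  rewrite inE => /andP[_ /andP[/= /eqP i_0 ij]]; exists j.
    by rewrite !inE -val_eqE i00 /=; lia.
  by congr (e _ + _); apply: val_inj; rewrite i00 /= i_0.
rewrite !inE -val_eqE i00 /= => j0; exists i0 j => //.
by rewrite !inE i00 /=; lia.
Qed.

(** The weight is positive, at most 2, and even. *)
Lemma wt_e_e n (i j : 'I_n) : i != j -> wt (e i + e j) = 2%N.
Proof.
move=> ij; have := wtD (e i) (e j); have := odd_wtD (e i) (e j).
have /wt_pos : e i != e j by rewrite (inj_eq (@e_inj n)).
by rewrite !wt_e; case: (wt _) => [|[|[|]]].
Qed.

(** [wt (y + z)] is 0 or 2, which leaves 1 or 3 modulo 4. With [e0 n] adjoined, weight 1 would occur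
    and leave 0. *)
Lemma compl_wt1 n : (n %% 4 = 1)%N ->
  {in [set e i | i : 'I_n] &, forall y z, ~~ (4 %| n - wt (y + z))%N}.
Proof.
move=> n1 _ _ /imsetP[i _ ->] /imsetP[j _ ->].
have [->|/wt_e_e ij] := eqVneq i j; last first.
  by have := wt_compl (e i + e j); rewrite ij; lia.
by rewrite addrowZ2_self [wt 0]wt_e0; lia.
Qed.

Lemma compl_wt3 n : (n %% 4 = 3)%N ->
  {in e0 n |: [set e i | i : 'I_n] &, forall y z, ~~ (4 %| n - wt (y + z))%N}.
Proof.
move=> n3 y z /wt_e0_e y1 /wt_e0_e z1.
by have := wtD y z; lia.
Qed.

Lemma wt_e0_eD n : {in e0 n |: [set e i | i : 'I_n] &,
  forall y z, y != z -> ~~ (4 %| wt (y + z))%N}.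
Proof.
by move=> y z /wt_e0_e y1 /wt_e0_e z1; apply: wtD_small; lia.
Qed.

Lemma modn4_cases n :
  ~~ (4 %| n)%N -> [\/ n %% 4 = 1, n %% 4 = 2 | n %% 4 = 3]%N.
Proof.
have : (n %% 4 < 4)%N by rewrite ltn_mod.
by rewrite /dvdn; case: (n %% 4)%N => [|[|[|[|]]]] // _ _;
  [apply: Or31|apply: Or32|apply: Or33].
Qed.

Lemma wt_HsetD n : (0 < n)%N -> ~~ (4 %| n)%N ->
  {in Hset n &, forall y z, y != z -> ~~ (4 %| wt (y + z))%N}.
Proof.
move=> n_gt0 n4.
have [n1|n2|n3] := modn4_cases n4.
- rewrite Hset1 //; apply: wt_double; first exact: compl_wt1.
  by move=> y z yA zA; apply: wt_e0_eD; rewrite inE ?yA ?zA orbT.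
- rewrite (@Hset2 _ (Ordinal n_gt0)) // => y z.
  set i0 := Ordinal n_gt0; rewrite inE [z \in _]inE.
  have he j : j \in [set~ i0] -> wt (e i0 + e j) = 2%N.
    by rewrite !inE eq_sym => /wt_e_e.
  move=> /orP[/wt_e0_e y1|/imsetP[j jP ->]] /orP[/wt_e0_e z1|/imsetP[k kP ->]].
  + by apply: wtD_small; lia.
  + by apply: wtD_small; rewrite he //; lia.
  + by apply: wtD_small; rewrite he //; lia.
  (* The bound 2 + 2 is too weak here; cancelling the common [e i0] leaves weight 2. *)
  + rewrite addrowZ2_cancel => jk; rewrite wt_e_e //.
    by apply: contraNneq jk => ->.
- by rewrite Hset3 //; apply: wt_double; [exact: compl_wt3|exact: wt_e0_eD].
Qed.

(** For [n] = 4m + l the count is 2n, (n + 1) + (n - 1) or 2(n + 1) as l = 1, 2, 3; each equals 8m +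
    2^l. *)
Lemma card_Hset n : (0 < n)%N -> ~~ (4 %| n)%N ->
  #|Hset n| = hurwitz_radon (2 ^ n).
Proof.
move=> n_gt0 n4; rewrite /hurwitz_radon pfactorK //.
have [n1|n2|n3] := modn4_cases n4.
- by rewrite Hset1 // card_double ?card_e ?n1; [lia|exact: compl_wt1].
- rewrite (@Hset2 _ (Ordinal n_gt0)) // n2; set i0 := Ordinal n_gt0.
  rewrite cardsU disjoint_setI0.
    rewrite cards0 card_e0_e card_imset ?cardsC1 ?card_ord; first lia.
    by move=> i j /addrI/e_inj.
  (* The two pieces are separated by weight: at most 1 against exactly 2. *)
  rewrite disjoint_sym disjoints_subset; apply/subsetP => y /imsetP[j + ->].
  rewrite in_setC1 eq_sym => ij; rewrite in_setC.
  by apply/negP => /wt_e0_e; rewrite wt_e_e.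
- by rewrite Hset3 // card_double ?card_e0_e ?n3; [lia|exact: compl_wt3].
Qed.

(** * Sign cancellation and the identity *)

Lemma f_oct_swap n (u y z : 'rV['Z_2]_n) : ~~ (4 %| wt (y + z))%N ->
  f_oct (u + y) z + f_oct (u + z) y = f_oct (u + y) y + f_oct (u + z) z + 1.
Proof.
move=> /f_oct_diag_eq1 <-; set w := y + z.
have -> : u + z = (u + y) + w.
  by rewrite /w addrA -[u + y + y]addrA addrowZ2_self addr0.
have fz v : f_oct v z = f_oct v y + f_oct v w.
  by rewrite -f_octDr /w addrA addrowZ2_self add0r.
rewrite !fz (f_octDl_diag (u + y) w).
set p := f_oct (u + y) y; set q := f_oct (u + y) w; set r := f_oct (u + y + w) y.
set s := f_oct w w.
(* The sides differ by [s + s]: one [s] comes from [f_octDl_diag], the other is the 1 of the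
   statement. *)
rewrite -[LHS]addr0 -(addZ2_self s) /s; ring.
Qed.

(* Splitting along a coordinate where [d] is nonzero avoids dividing by 2. *)
Lemma sum_antiperiodic (V : zmodType) n (d : 'rV['Z_2]_n)
    (T : 'rV['Z_2]_n -> V) :
  d != 0 -> (forall x, T (x + d) = - T x) -> \sum_x T x = 0.
Proof.
move=> d0 Td; have [i di] : exists i, d 0 i != 0.
  apply/existsP; apply: contraNT d0 => /existsPn d0.
  by apply/eqP/rowP => i; rewrite mxE; apply/eqP; rewrite -[_ == _]negbK d0.
pose P (x : 'rV['Z_2]_n) := x 0 i == 0.
have Pd x : ~~ P (x + d) = P x.
  rewrite /P mxE; move: (x 0 i) (d 0 i) di.
  by do 2![case=> [[|[|]] ?] //].
rewrite (bigID P) /= [X in _ + X](reindex_inj (addIr d)) /=.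
rewrite (eq_bigl _ _ Pd) -big_split big1 // => x _.
by rewrite /= Td subrr.
Qed.

Theorem theorem4 (n : nat) (n_ge1 : (1 <= n)%N) (n_not_mul4 : ~~ (4 %| n)%N) :
  #|Hset n| = hurwitz_radon (2 ^ n)
  /\ forall (R : comNzRingType) (a b : 'rV['Z_2]_n -> R),
       (\sum_(x : 'rV['Z_2]_n) a x ^+ 2) * (\sum_(y in Hset n) b y ^+ 2)
       = \sum_(x : 'rV['Z_2]_n) cform a b x ^+ 2.
Proof.
split; first exact: card_Hset.
(* [t y x] is the coefficient of [b y] in [cform a b x]. It suffices that the vectors [t y] are
   pairwise orthogonal and share the squared norm of [a]. *)
move=> R a b; pose t y x : R := (-1) ^+ f_oct (x + y) y * a (x + y).
have tt_eq y : \sum_x t y x * t y x = \sum_x a x ^+ 2.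
  rewrite [RHS](reindex_inj (addIr y)) /=; apply: eq_bigr => x _.
  by rewrite -expr2 exprMn sqrr_sign mul1r.
have tt_neq y z : y \in Hset n -> z \in Hset n -> y != z ->
    \sum_x t y x * t z x = 0.
  (* Translating [x] by [y + z] exchanges [a (x + y)] and [a (x + z)], while [f_oct_swap] makes the
     sign flip. *)
  move=> yH zH yz; apply: (@sum_antiperiodic _ _ (y + z)).
    by rewrite -wt_eq0 -lt0n wt_pos.
  move=> x; have sw := f_oct_swap x (wt_HsetD n_ge1 n_not_mul4 yH zH yz).
  have xz : x + (y + z) + y = x + z.
    by rewrite -addrA [y + z]addrC -addrA addrowZ2_self addr0.
  have xy : x + (y + z) + z = x + y.
    by rewrite -!addrA addrowZ2_self addr0.
  have /(congr1 (fun k : 'Z_2 => (-1) ^+ k : R)) := sw.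
  rewrite /t xz xy !signrZ2D mulrN1 => sgn.
  by rewrite mulrACA [X in X * _]mulrC sgn mulNr [a (x + z) * _]mulrC -mulrACA.
have sq_cform x : cform a b x ^+ 2 =
    \sum_(y in Hset n) \sum_(z in Hset n) (t y x * b y) * (t z x * b z).
  by rewrite expr2 -big_distrlr.
rewrite (eq_bigr _ (fun x _ => sq_cform x)) mulr_sumr [RHS]exchange_big.
apply: eq_bigr => y yH.
(* With the sum over [x] innermost, only [z = y] survives. *)
rewrite [RHS]exchange_big [RHS](bigD1 y) //= [X in _ + X]big1 ?addr0.
  rewrite -(tt_eq y) mulr_suml; apply: eq_bigr => x _; ring.
move=> z /andP[zH zy].
transitivity (b y * b z * \sum_x t y x * t z x).
  by rewrite mulr_sumr; apply: eq_bigr => x _; ring.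
by rewrite tt_neq ?mulr0 // eq_sym.
Qed.
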